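(* Let $(k_n)_{n=1}^\infty$ be a nondecreasing sequence of positive integers such that $k_n\to\infty$ and $k_n=o(n)$. Then, under the measures $\mathbb{P}_{n,k_n}$, $$\frac{I-\mathbb{E}_{n,k_n}(I)}{\sqrt{\mathrm{Var}_{n,k_n}(I)}}\longrightarrow Z\quad\text{in distribution, as } n\to\infty,$$ where $Z$ is a standard normal random variable.
   Context: For positive integers $k,n$, the $k$-card-minimum ($k$CM) procedure generates a random permutation of $\{1,\dots,n\}$ as follows. Let $D_1=\{1,\dots,n\}$. For $t=1,\dots,n$: given the past, $C_{t,1},\dots,C_{t,k}$ are i.i.d. uniform samples from $D_t$; $C_t=\min\{C_{t,1},\dots,C_{t,k}\}$; and $D_{t+1}=D_t\setminus\{C_t\}$. The resulting permutation is $\sigma=(C_1,\dots,C_n)$. $\mathbb{P}_{n,k}$ denotes the probability measure of this procedure with parameters $n,k$, and $\mathbb{E}_{n,k}$, $\mathrm{Var}_{n,k}$ denote expectation and variance under it. $I=I(\sigma)=|\{i<j:\sigma(i)>\sigma(j)\}|$ is the number of inversions of $\sigma$. *)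

(* Defs.v *)
From HB Require Import structures.
From mathcomp Require Import all_boot all_order all_algebra.
From mathcomp Require Import all_classical all_reals all_analysis.
Set Implicit Arguments.
Unset Strict Implicit.
Unset Printing Implicit Defensive.
Import Order.TTheory GRing.Theory Num.Theory.
Import numFieldNormedType.Exports.
Local Open Scope classical_set_scope.
Local Open Scope ring_scope.

(* Cards and times are 0-based: 'I_n stands for {1, ..., n}.
   An outcome of the k-card-minimum procedure is the array of all the sampled
   cards: w t i is the i-th card sampled at time t. *)
Definition samples (n k : nat) := {ffun 'I_n -> {ffun 'I_k -> 'I_n}}.

HB.instance Definition _ n k := Finite.on (samples n k).
HB.instance Definition _ n k :=
  isPointed.Build (samples n k) [ffun t => [ffun=> t]].
HB.instance Definition _ n k := @isMeasurable.Build default_measure_display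
  (samples n k) discrete_measurable discrete_measurable0
  discrete_measurableC discrete_measurableU.

Section kcm.
Context {n k : nat}.
Implicit Types (w : samples n k) (s t : 'I_n).

(* C_t = min {w t i | i < k}. The default value t of the arg min is returned
   only if k = 0, where there is no procedure. *)
Definition kcm_card w t : 'I_n :=
  [arg min_(c < t | c \in codom (w t)) val c]%N.

(* D_t = {1, ..., n} \ {C_s | s < t} *)
Definition kcm_deck w t : {set 'I_n} :=
  [set c | [forall s : 'I_n, (s < t)%N ==> (kcm_card w s != c)]].

End kcm.

(* Chain rule: given the past, the k cards sampled at time t are independent
   and uniform on D_t. *)
Definition kcm_pmf {R : realType} n k (w : samples n k) : R :=
  \prod_(t < n) \prod_(i < k)
    (if w t i \in kcm_deck w t then #|kcm_deck w t|%:R^-1 else 0).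

Lemma kcm_pmf_ge0 {R : realType} n k (w : samples n k) : 0 <= kcm_pmf w :> R.
Proof.
by apply: prodr_ge0 => t _; apply: prodr_ge0 => i _; case: ifP.
Qed.

Lemma kcm_card_in n k (w : samples n k.+1) t : kcm_card w t \in codom (w t).
Proof.
rewrite /kcm_card /arg_min /extremum; case: pickP => [i /andP[]//|h].
have [i] := @arg_minnP _ (w t ord0) (mem (codom (w t))) val (codom_f _ _).
move=> iw imin; have /negP[] := negbT (h i); apply/andP; split=> //.
by apply/forallP => j; apply/implyP => /imin.
Qed.

(* On the support of the law, (C_1, ..., C_n) is a permutation. *)
Lemma kcm_card_inj {R : realType} n k (w : samples n k.+1) :
  kcm_pmf w != 0 :> R -> injective (kcm_card w).
Proof.
move=> w0.
have inD t : kcm_card w t \in kcm_deck w t.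
  have /codomP[i ->] := kcm_card_in w t.
  apply: contraNT w0 => wD; rewrite /kcm_pmf (bigD1 t)//= (bigD1 i)//=.
  by rewrite (negbTE wD) !mul0r.
have ltC (s t : 'I_n) : (s < t)%N -> kcm_card w s != kcm_card w t.
  by move=> st; have := inD t; rewrite inE => /forallP/(_ s); rewrite st.
move=> s t Cst; apply/val_inj => /=; case: (ltngtP s t) => // /ltC.
- by rewrite Cst eqxx.
- by rewrite Cst eqxx.
Qed.

Section kcm_pmf_sum.
Context {R : realType} (n k : nat).
Implicit Types (w : samples n k) (t : 'I_n) (v : {ffun 'I_k -> 'I_n}).

Let q w t v : R :=
  \prod_(i < k) (if v i \in kcm_deck w t then #|kcm_deck w t|%:R^-1 else 0).

Let upd w t v : samples n k := [ffun s => if s == t then v else w s].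

Let kcm_card_upd w t v s : s != t -> kcm_card (upd w t v) s = kcm_card w s.
Proof. by move=> st; rewrite /kcm_card ffunE (negbTE st). Qed.

Let kcm_deck_upd w t v (s : 'I_n) : (s <= t)%N ->
  kcm_deck (upd w t v) s = kcm_deck w s.
Proof.
move=> st; apply/setP => c; rewrite !inE; apply: eq_forallb => r;
case: ltnP => //= rs; rewrite kcm_card_upd//.
by rewrite -val_eqE /= neq_ltn (leq_trans rs st).
Qed.

Let q_upd w t v (s : 'I_n) v' : (s <= t)%N -> q (upd w t v) s v' = q w s v'.
Proof. by move=> st; rewrite /q kcm_deck_upd. Qed.

Let sum_q w t : \sum_v q w t v = 1.
Proof.
rewrite /q -(bigA_distr_bigA (fun=> fun x =>
  if x \in kcm_deck w t then #|kcm_deck w t|%:R^-1 else 0 : R)) big1// => i _.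
rewrite -big_mkcond /= sumr_const -[X in X *+ _]mulr1 -mulrnAr mulVf//.
rewrite pnatr_eq0 -lt0n.
pose A := [set s : 'I_n | (s < t)%N]%SET.
have -> : kcm_deck w t = (~: (kcm_card w @: A))%SET.
  apply/setP => c; rewrite !inE; apply/forallP/idP => [h|/negP h s].
    apply/imsetP => -[s]; rewrite inE => st cs.
    by have := h s; rewrite st cs eqxx.
  apply/implyP => st; apply/eqP => sc; apply: h.
  by apply/imsetP; exists s; rewrite ?inE.
rewrite -(ltn_add2l #|(kcm_card w @: A)%SET|) addn0 cardsC card_ord.
apply: leq_ltn_trans (leq_imset_card _ _) _; apply: leq_ltn_trans _ (ltn_ord t).
pose B := [set widen_ord (ltnW (ltn_ord t)) s | s : 'I_t]%SET.
apply: (@leq_trans #|B|); last first.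
  by rewrite (leq_trans (leq_imset_card _ _))// card_ord.
apply/subset_leq_card/fintype.subsetP => s; rewrite inE => st.
by apply/imsetP; exists (Ordinal st) => //; apply/val_inj.
Qed.

Let sum_upd t (f : samples n k -> R) :
  \sum_w \sum_v f (upd w t v) = #|{ffun 'I_k -> 'I_n}|%:R * \sum_w f w.
Proof.
rewrite pair_big /=.
pose h (p : samples n k * {ffun 'I_k -> 'I_n}) := (upd p.1 t p.2, p.1 t).
have hK : involutive h.
  move=> [w v]; rewrite /h /=; congr pair; last by rewrite ffunE eqxx.
  by apply/ffunP => s; rewrite !ffunE; case: eqVneq => // ->.
rewrite (reindex_inj (inv_inj hK)) /=.
rewrite (eq_bigr (fun p => f p.1)); last first.
  move=> [w v] _ /=; congr f; have := hK (w, v); rewrite /h /=.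
  by move=> [].
rewrite -(pair_big xpredT xpredT (fun w v => f w)) /=.
by rewrite mulr_sumr; apply: eq_bigr => w _; rewrite sumr_const mulr_natl.
Qed.

Lemma sum_kcm_pmf : \sum_(w : samples n k) kcm_pmf w = 1 :> R.
Proof.
pose V := #|{ffun 'I_k -> 'I_n}|.
pose F j w := \prod_(t < n | (t < j)%N) q w t (w t).
have S j : (j <= n)%N -> V%:R ^+ j * (\sum_w F j w) = V%:R ^+ n :> R.
  elim: j => [_|j IH jn].
    rewrite expr0 mul1r (eq_bigr (fun=> 1)) => [|w _].
    2: by rewrite /F big_pred0.
    by rewrite sumr_const card_ffun card_ord natrX.
  rewrite -IH ?(ltnW jn)// exprSr -mulrA; congr (_ * _).
  pose t := Ordinal jn.
  rewrite -(sum_upd t); apply: eq_bigr => w _.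
  rewrite -[RHS]mulr1 -(sum_q w t) mulr_sumr; apply: eq_bigr => v _.
  rewrite /F (bigD1 t)//= mulrC ffunE eqxx q_upd//; congr (_ * _).
  apply: eq_big => [s|s /andP[sj st]].
    by rewrite ltnS -val_eqE /= andbC -ltn_neqAle.
  by rewrite q_upd ?ffunE ?(negbTE st).
have [n0|n0] := posnP n.
  rewrite (eq_bigr (fun=> 1)) => [|w _]; last first.
    by rewrite /kcm_pmf big1// => -[m mn]; exfalso; move: mn; rewrite n0.
  rewrite sumr_const card_ffun card_ord.
  by move: n0 => ->; rewrite expn0.
have V0 : V%:R != 0 :> R.
  by rewrite pnatr_eq0 /V card_ffun !card_ord expn_eq0 (gtn_eqF n0).
have := S n (leqnn n); rewrite -[RHS]mulr1 => /(mulfI (expf_neq0 _ V0)) <-.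
by apply: eq_bigr => w _; apply: eq_bigl => t; rewrite ltn_ord.
Qed.

End kcm_pmf_sum.

Definition kcm_prob (R : realType) n k : set (samples n k) -> \bar R :=
  fun U => (\esum_(w in U) (kcm_pmf w)%:E)%E.
Arguments kcm_prob R n k _ : clear implicits.

Section kcm_probability.
Context (R : realType) (n k : nat).
Local Open Scope ereal_scope.
Local Notation kcm := (kcm_prob R n k).

Let kcm0 : kcm set0 = 0. Proof. exact: esum_set0. Qed.

Let kcm_ge0 U : 0 <= kcm U.
Proof. by apply: esum_ge0 => w _; rewrite lee_fin kcm_pmf_ge0. Qed.

Let kcm_sigma_additive : semi_sigma_additive kcm.
Proof.
move=> F mF tF mUF; apply: cvg_toP.
  apply: ereal_nondecreasing_is_cvgn => a b ab.
  by apply: lee_sum_nneg_natr => // i _ _; exact: kcm_ge0.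
by rewrite /kcm_prob nneseries_sum_bigcup// => w; rewrite lee_fin kcm_pmf_ge0.
Qed.

HB.instance Definition _ := isMeasure.Build _ _ _ kcm
  kcm0 kcm_ge0 kcm_sigma_additive.

Let kcm_setT : kcm [set: _] = 1.
Proof.
have E : [set: samples n k] = [set` index_enum (samples n k)].
  by apply/seteqP; split => w //= _; rewrite mem_index_enum.
rewrite /kcm_prob esum_fset; [|exact: finite_finset|]; last first.
  by move=> w _; rewrite lee_fin kcm_pmf_ge0.
by rewrite E -fsbig_seq ?index_enum_uniq// sumEFin sum_kcm_pmf.
Qed.

HB.instance Definition _ := @Measure_isProbability.Build _ _ R kcm kcm_setT.

End kcm_probability.

Definition inversions n (s : 'I_n -> 'I_n) : nat :=
  #|[set p : 'I_n * 'I_n | (p.1 < p.2)%N && (s p.2 < s p.1)%N]%SET|.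

Section inversions.
Context (R : realType) (n k : nat).

Definition kcm_inv (w : samples n k) : R := (inversions (kcm_card w))%:R.

(* For n <= 1 the variance is 0 and the quotient is 0 by convention. *)
Definition std_kcm_inv (w : samples n k) : R :=
  (kcm_inv w - fine 'E_(kcm_prob R n k)[kcm_inv]) /
  Num.sqrt (fine 'V_(kcm_prob R n k)[kcm_inv]).

HB.instance Definition _ := @isMeasurableFun.Build _ _ (samples n k) R
  std_kcm_inv (fun _ _ _ => I).

End inversions.
Arguments kcm_inv R n k _ : clear implicits.
Arguments std_kcm_inv R n k _ : clear implicits.

Definition cvg_in_distribution (R : realType)
    (d : nat -> measure_display) (T : forall n, measurableType (d n))
    (P : forall n, probability (T n) R) (X : forall n, {RV (P n) >-> R})
    (d' : measure_display) (T' : measurableType d') (P' : probability T' R)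
    (Z : {RV P' >-> R}) : Prop :=
  forall x : R, {for x, continuous (cdf Z)} ->
    cdf (X n) x @[n --> \oo] --> cdf Z x.

(* normal_prob is only meaningful on measurable sets. *)
Definition standard_normal (R : realType) (d : measure_display)
    (T : measurableType d) (P : probability T R) (Z : {RV P >-> R}) : Prop :=
  forall A : set R, measurable A -> distribution P Z A = normal_prob 0 1 A.

(* Main.v *)
Require Import Defs.
From mathcomp Require Import all_boot all_order all_algebra.
From mathcomp Require Import all_classical all_reals all_analysis.
From HB Require Import structures.
From mathcomp Require Import ring lra zify.
Import numFieldNormedType.Exports.
Import Order.TTheory GRing.Theory Num.Theory.
Local Open Scope classical_set_scope.
Local Open Scope ring_scope.
Set Implicit Arguments.
Unset Strict Implicit.
Unset Printing Implicit Defensive.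

(** At each time the only information that matters for the number of
    inversions is the rank, inside the current deck, of the card that is
    removed: a pair is an inversion exactly when its smaller card is still in
    the deck at the time its larger card is drawn, so the number of inversions
    is the sum of these ranks ([inversionsE]). When [m] cards are left, the
    rank is the minimum of [k] uniform samples of [{0, ..., m - 1}], whatever
    the deck looks like ([sum_min_samples]). Integrating the samples out one
    time step after the other, from the last one to the first, shows that the
    number of inversions has the law of [Y_1 + ... + Y_n] with independent
    [Y_m], where [Pr (Y_m >= y) = ((m - y) / m) ^ k] ([sum_kcm_inversions]).

    The [Y_m] are of order [b = n / k]: their binomial moments are at most the
    powers of [m / k] ([min_binomial_moment]), so that third moments are [O (b
    ^ 3)], while the variance of [Y_m] is at least a constant times [(m / k) ^
    2] ([min_var_ge]). The total variance is therefore at least a constant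
    times [n * b ^ 2], and the Lyapunov ratio is of order [n * b ^ 3 / (n * b
    ^ 2) ^ (3 / 2) = n ^ (- 1 / 2)].

    The central limit theorem is proved by exchanging the [Y_m] one by one
    against Gaussian variables. With [Phi] the normal distribution function,
    the function [Phi (z / sqrt t)] solves the heat equation explicitly:
    adding to [z] a centered variable of variance [v] has, up to an error of
    third order, the same effect as replacing [t] by [t + v] ([heat_step]).
    Exchanging all the terms, starting at time [e] times the total variance,
    compares the expectation of [Phi ((a - W) / sqrt e)], for the standardized
    number of inversions [W], with [Phi (a / sqrt (1 + e))]
    ([rank_mean_smooth_le]). As [Phi ((a - w) / sqrt e)] is itself a smoothing
    of the indicator function of [w <= a], a sandwich argument with [a] close
    to [x] and then [e] small gives the convergence of the distribution
    functions ([kcm_cdf_cvg]). *)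

(** * Taylor bounds and the normal distribution function *)

Section taylor.
Context {R : realType}.
Implicit Types (f df : R -> R) (a b M : R).

(** The order of [a] and [b] is left open, as increments of both signs occur. *)
Lemma norm_increment_le f df a b M :
  (forall x, x \in `[Num.min a b, Num.max a b] -> is_derive x 1 f (df x)) ->
  (forall x, x \in `[Num.min a b, Num.max a b] -> `|df x| <= M) ->
  `|f b - f a| <= M * `|b - a|.
Proof.
wlog ab : a b / a <= b.
  move=> W; have /orP[|ba] := le_total a b; first exact: W.
  by rewrite distrC (distrC b) minC maxC; exact: W.
rewrite min_l// max_r// => df_f dfM.
have fc : {within `[a, b], continuous f}.
  by apply: derivable_within_continuous => x /df_f[].
have df_oo x : x \in `]a, b[ -> is_derive x 1 f (df x).
  by move=> xab; apply: df_f; exact: subset_itv_oo_cc.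
have [c cab E] := MVT_segment ab df_oo fc.
by rewrite E normrM ler_wpM2r// dfM.
Qed.

Lemma itv_between_dist a b x :
  x \in `[Num.min a b, Num.max a b] -> `|x - a| <= `|b - a|.
Proof.
rewrite in_itv/= => /andP[]; have [ab|ba] := leP a b => ax xb.
- by rewrite !ger0_norm ?subr_ge0// lerD2r.
- rewrite distrC (distrC b) !ger0_norm ?subr_ge0 ?lerD2l ?lerN2//.
  exact: ltW.
Qed.

Lemma itv_between_sub a b x y :
  x \in `[Num.min a b, Num.max a b] -> y \in `[Num.min a x, Num.max a x] ->
  y \in `[Num.min a b, Num.max a b].
Proof.
rewrite !in_itv/= => /andP[ax xb] /andP[ay yb]; apply/andP; split.
- by rewrite (le_trans _ ay)// le_min ax ge_min lexx.
- by rewrite (le_trans yb)// ge_max xb le_max lexx.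
Qed.

(** The constants in the Taylor bounds are not sharp: the mean value theorem is
    applied to the remainder itself, whose derivative is a remainder of lower
    order. *)
Lemma taylor1 f (f1 f2 : R -> R) a b M :
  (forall x, x \in `[Num.min a b, Num.max a b] -> is_derive x 1 f (f1 x)) ->
  (forall x, x \in `[Num.min a b, Num.max a b] -> is_derive x 1 f1 (f2 x)) ->
  (forall x, x \in `[Num.min a b, Num.max a b] -> `|f2 x| <= M) ->
  `|f b - f a - (b - a) * f1 a| <= M * `|b - a| ^+ 2.
Proof.
move=> df df1 f2M.
have E : f b - f a - (b - a) * f1 a =
   (f - (fun x => x * f1 a)) b - (f - (fun x => x * f1 a)) a.
  by rewrite !fctE; ring.
rewrite E expr2 mulrA.
apply: (@norm_increment_le _ (fun x => f1 x - f1 a)) => x xab.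
  have ? := df x xab; apply: is_deriveB.
  by apply: is_derive_eq; rewrite /GRing.scale/= mulr0 add0r mulr1.
have sub y := @itv_between_sub a b x y xab.
have := norm_increment_le (fun y yax => df1 y (sub y yax))
  (fun y yax => f2M y (sub y yax)).
move=> h; apply: le_trans h _.
by rewrite ler_wpM2l ?itv_between_dist// (le_trans _ (f2M _ xab)).
Qed.

Lemma taylor2 f (f1 f2 f3 : R -> R) a b M :
  (forall x, x \in `[Num.min a b, Num.max a b] -> is_derive x 1 f (f1 x)) ->
  (forall x, x \in `[Num.min a b, Num.max a b] -> is_derive x 1 f1 (f2 x)) ->
  (forall x, x \in `[Num.min a b, Num.max a b] -> is_derive x 1 f2 (f3 x)) ->
  (forall x, x \in `[Num.min a b, Num.max a b] -> `|f3 x| <= M) ->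
  `|f b - f a - (b - a) * f1 a - (b - a) ^+ 2 / 2 * f2 a| <=
  M * `|b - a| ^+ 3.
Proof.
move=> df df1 df2 f3M.
pose g := (f - (fun x => x * f1 a)) - (fun x => f2 a / 2 * (x - a) ^+ 2).
have -> : f b - f a - (b - a) * f1 a - (b - a) ^+ 2 / 2 * f2 a = g b - g a.
  by rewrite /g !fctE; field.
rewrite exprSr mulrA.
apply: (@norm_increment_le _ (fun x => f1 x - f1 a - (x - a) * f2 a)) => x xab.
  have ? := df x xab; apply: is_deriveB; first apply: is_deriveB.
    by apply: is_derive_eq; rewrite /GRing.scale/= mulr0 add0r mulr1.
  by apply: is_derive_eq; rewrite /GRing.scale/= /cst/=; field.
have M0 : 0 <= M by rewrite (le_trans _ (f3M _ xab)).
have sub y := @itv_between_sub a b x y xab.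
have := taylor1 (fun y yax => df1 y (sub y yax))
  (fun y yax => df2 y (sub y yax)) (fun y yax => f3M y (sub y yax)).
move=> h; apply: le_trans h _.
by rewrite ler_wpM2l// ler_pXn2r ?nnegrE// itv_between_dist.
Qed.

End taylor.

Section gaussian.
Context {R : realType}.
Implicit Types x u : R.

Definition std_normal_cdf x : R := fine (normal_prob 0 1 `]-oo, x]).
Local Notation Phi := std_normal_cdf.
Local Notation phi := (normal_pdf (0 : R) 1).

Lemma std_normal_pdfE x : phi x = normal_peak 1 * expR (- (x ^+ 2 / 2)).
Proof.
rewrite normal_pdfE ?oner_neq0// /normal_fun subr0 expr1n mulNr.
by rewrite -[1 *+ 2]/(2%:R).
Qed.

Lemma is_derive_std_normal_pdf x : is_derive x 1 phi (- (x * phi x)).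
Proof.
have E : phi = normal_peak 1 \*: (expR \o (fun x => (- 2^-1) * x ^+ 2)).
  by apply/funext => y; rewrite std_normal_pdfE /= mulNr [2^-1 * _]mulrC.
have D : is_derive x 1 (fun x => - 2^-1 * x ^+ 2) (- x :> R).
  by apply: is_derive_eq; rewrite /GRing.scale/= /cst/=; field.
have D1 := @is_derive1_comp _ expR (fun x => - 2^-1 * x ^+ 2) _ _ _
  (is_derive_expR _) D.
have := is_deriveZ (normal_peak (1 : R)) D1.
rewrite -E std_normal_pdfE => /is_derive_eq; apply.
by rewrite /GRing.scale/= mulNr [2^-1 * _]mulrC; ring.
Qed.

Lemma is_derive_std_normal_cdf x : is_derive x 1 Phi (phi x).
Proof.
have [||||D E] := @continuous_FTC1 R phi (BInfty R true) x (x + 1).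
- by rewrite ltrDl.
- by apply: integrableS (integrable_normal_pdf 0 1).
- by rewrite ltNyr.
- by apply: continuous_normal_pdf; rewrite oner_neq0.
- apply: DeriveDef; first exact: D.
  by rewrite -E derive1E.
Qed.


(** All derivatives of [Phi] that occur below are polynomials of degree at most
    3 times the density, up to bounded factors, so this single bound controls
    them. *)
Lemma std_normal_pdf_poly_bounded : exists2 C : R, 0 < C &
  forall x, (1 + `|x| + `|x| ^+ 2 + `|x| ^+ 3) * phi x <= C.
Proof.
have p0 : 0 < normal_peak (1 : R) by rewrite normal_peak_gt0// oner_neq0.
exists (16 * normal_peak 1); first by rewrite mulr_gt0.
move=> x; rewrite std_normal_pdfE mulrCA mulrC ler_pM2r//.
rewrite expRN ler_pdivrMr ?expR_gt0//.
(* the square makes [1 + y <= expR y] yield a bound of degree 4 in [x] *)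
have -> : expR (x ^+ 2 / 2) = expR (`|x| ^+ 2 / 4) ^+ 2.
  by rewrite real_normK ?num_real// -expRM_natl; congr expR; field.
have y0 := normr_ge0 x; move: (`|x|) y0 => y y0.
apply: (@le_trans _ _ (16 * (1 + y ^+ 2 / 4) ^+ 2)).
  have := sqr_ge0 (y * (y - 1)); have := sqr_ge0 (y - 1); have := sqr_ge0 y.
  by nra.
rewrite ler_pM2l// ler_pXn2r ?nnegrE ?expR_ge0 ?expR_ge1Dx//.
by rewrite addr_ge0// divr_ge0// sqr_ge0.
Qed.

Lemma std_normal_cdf_lipschitz : exists2 C : R, 0 < C &
  forall x y, `|Phi y - Phi x| <= C * `|y - x|.
Proof.
exists (normal_peak 1); first by rewrite normal_peak_gt0// oner_neq0.
move=> x y; apply: (norm_increment_le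
  (fun z _ => is_derive_std_normal_cdf z)) => z _.
by rewrite ger0_norm ?normal_pdf_ge0 ?normal_pdf_ub ?oner_neq0.
Qed.

Lemma std_normal_cdf_taylor2 : exists2 C : R, 0 < C &
  forall u h, `|Phi (u + h) - Phi u - h * phi u + h ^+ 2 / 2 * (u * phi u)| <=
    C * `|h| ^+ 3.
Proof.
have [C C0 phiC] := std_normal_pdf_poly_bounded.
exists C => // u h; have uhu : u + h - u = h by ring.
suff : `|Phi (u + h) - Phi u - (u + h - u) * phi u -
    (u + h - u) ^+ 2 / 2 * (- (u * phi u))| <= C * `|u + h - u| ^+ 3.
  by rewrite uhu mulrN opprK.
apply: (@taylor2 _ _ phi (fun x => - (x * phi x))
  (fun x => (x ^+ 2 - 1) * phi x)) => x _.
- exact: is_derive_std_normal_cdf.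
- exact: is_derive_std_normal_pdf.
- have ? := is_derive_std_normal_pdf x; apply: is_derive_eq.
  by rewrite /GRing.scale/=; ring.
- apply: le_trans (phiC x); rewrite normrM (ger0_norm (normal_pdf_ge0 _ _ _)).
  rewrite ler_wpM2r ?normal_pdf_ge0// (le_trans (ler_normB _ _))//.
  by rewrite normr1 normrX; have := normr_ge0 x;
    have := exprn_ge0 3 (normr_ge0 x); lra.
Qed.

(** The first-order effect of the rescaling is [w / 2] times the second
    derivative [- u * phi u] of [Phi]: this is the heat equation for [Phi (u /
    sqrt t)] at [t = 1]. Expanding in [r = sqrt (1 + w)] rather than in [w]
    keeps the derivatives rational. *)
Lemma std_normal_cdf_scale : exists2 C : R, 0 < C &
  forall u w, 0 <= w ->
    `|Phi (u / Num.sqrt (1 + w)) - Phi u + w / 2 * (u * phi u)| <= C * w ^+ 2.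
Proof.
have [C C0 phiC] := std_normal_pdf_poly_bounded.
exists (2 * C) => [|u w w0]; first by rewrite mulr_gt0.
set r := Num.sqrt (1 + w).
have r2 : r ^+ 2 = 1 + w by rewrite sqr_sqrtr// addr_ge0.
have r1 : 1 <= r by rewrite -sqrtr1 ler_wsqrtr// lerDl.
have wE : w = (r - 1) * 2 + (r - 1) ^+ 2.
  by apply: (addrI 1); rewrite -r2; ring.
have phiu : `|u * phi u| <= C.
  apply: le_trans (phiC u); rewrite normrM (ger0_norm (normal_pdf_ge0 _ _ _)).
  rewrite ler_wpM2r ?normal_pdf_ge0//.
  by have := normr_ge0 u; have := exprn_ge0 3 (normr_ge0 u);
     have := exprn_ge0 2 (normr_ge0 u); lra.
have T : `|Phi (u / r) - Phi (u / 1) - (r - 1) * (- (u / 1 / 1) * phi (u / 1))|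
    <= 2 * C * `|r - 1| ^+ 2.
  have jE x : x \in `[Num.min 1 r, Num.max 1 r] -> 1 <= x.
    by rewrite in_itv/= min_l// => /andP[].
  have dV x : 1 <= x -> is_derive x 1 (fun x => u / x) (- (u / x / x)).
    move=> x1; have x0 : x != 0 by rewrite gt_eqF// (lt_le_trans _ x1).
    have ? := is_deriveV x0 (is_derive_id x 1).
    by apply: is_derive_eq; rewrite /GRing.scale/=; field.
  pose F x := Phi (u / x).
  pose F1 x := - (u / x / x) * phi (u / x).
  pose F2 x := (2 * (u / x) - (u / x) ^+ 3) / x ^+ 2 * phi (u / x).
  apply: (@taylor1 R F F1 F2 1 r (2 * C)) => x /jE x1; rewrite /F /F1 /F2.
  - have ? := dV _ x1.
    have D := @is_derive1_comp _ Phi (fun x => u / x) _ _ _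
      (is_derive_std_normal_cdf (u / x)) (dV _ x1).
    by apply: is_derive_eq D _; rewrite mulrC.
  - have x0 : x != 0 by rewrite gt_eqF// (lt_le_trans _ x1).
    have D := @is_derive1_comp _ phi (fun x => u / x) _ _ _
      (is_derive_std_normal_pdf (u / x)) (dV _ x1).
    have ? := dV _ x1.
    have ? := is_deriveV x0 (is_derive_id x 1).
    have := is_deriveM (is_deriveN (is_deriveM (dV _ x1)
      (is_deriveV x0 (is_derive_id x 1)))) D.
    move/is_derive_eq; apply; rewrite /GRing.scale/= ?fctE.
    by move: (normal_pdf _ _ _) => p; field.
  - apply: (@le_trans _ _ (2 * ((1 + `|u / x| + `|u / x| ^+ 2 +
        `|u / x| ^+ 3) * phi (u / x)))).
      rewrite normrM (ger0_norm (normal_pdf_ge0 _ _ _)) [leRHS]mulrA.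
      apply: ler_wpM2r; first exact: normal_pdf_ge0.
      rewrite normrM.
      apply: (@le_trans _ _ `|2 * (u / x) - (u / x) ^+ 3|).
        rewrite ler_piMr// ger0_norm ?invr_ge0 ?exprn_ge0 ?(le_trans _ x1)//.
        by rewrite invf_le1 ?exprn_ege1// exprn_gt0// (lt_le_trans _ x1).
      rewrite (le_trans (ler_normB _ _))// normrM normrX ger0_norm//.
      have := exprn_ge0 2 (normr_ge0 (u / x));
        have := exprn_ge0 3 (normr_ge0 (u / x)); lra.
    by rewrite ler_pM2l.
rewrite !divr1 mulNr mulrN opprK in T.
have -> : Phi (u / r) - Phi u + w / 2 * (u * phi u) =
  (Phi (u / r) - Phi u + (r - 1) * (u * phi u)) +
    (r - 1) ^+ 2 / 2 * (u * phi u).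
  by rewrite [w in LHS]wE; field.
have wr : 4 * (r - 1) ^+ 2 <= w ^+ 2.
  have -> : 4 * (r - 1) ^+ 2 = ((r - 1) * 2) ^+ 2 by ring.
  rewrite ler_pXn2r ?nnegrE//; first by rewrite [leRHS]wE lerDl sqr_ge0.
  by rewrite mulr_ge0// subr_ge0.
apply: le_trans (ler_normD _ _) _.
have : `|(r - 1) ^+ 2 / 2 * (u * phi u)| <= (r - 1) ^+ 2 / 2 * C.
  by rewrite normrM ger0_norm ?divr_ge0 ?sqr_ge0// ler_wpM2l// divr_ge0
    ?sqr_ge0.
move: T; rewrite real_normK ?num_real// => T T2.
apply: le_trans (lerD T T2) _.
have := ler_wpM2l (ltW C0) wr; have := mulr_ge0 (ltW C0) (sqr_ge0 (r - 1)); lra.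
Qed.

(** The second-order Taylor terms of [Phi (u - xi)] average to the first-order
    effect of rescaling ([std_normal_cdf_scale]); only remainders are left. *)
Lemma heat_step_time1 : exists2 C : R, 0 < C &
  forall m (p xi : 'I_m -> R) u v, (forall i, 0 <= p i) ->
    \sum_i p i = 1 -> \sum_i p i * xi i = 0 ->
    \sum_i p i * xi i ^+ 2 = v ->
    `|\sum_i p i * Phi (u - xi i) - Phi (u / Num.sqrt (1 + v))| <=
      C * (\sum_i p i * `|xi i| ^+ 3 + v ^+ 2).
Proof.
have [C C0 T] := std_normal_cdf_taylor2.
have [D D0 S] := std_normal_cdf_scale.
exists (C + D) => [|m p xi u v p0 p1 pxi vE]; first exact: addr_gt0.
have v0 : 0 <= v.
  by rewrite -vE; apply: sumr_ge0 => i _; rewrite mulr_ge0 ?sqr_ge0.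
pose r i := Phi (u + - xi i) - Phi u - (- xi i) * phi u +
            (- xi i) ^+ 2 / 2 * (u * phi u).
have rE : \sum_i p i * r i =
    \sum_i p i * Phi (u - xi i) - Phi u + v / 2 * (u * phi u).
  rewrite (eq_bigr (fun i => p i * Phi (u - xi i) - p i * Phi u +
    p i * xi i * phi u + p i * xi i ^+ 2 * (2^-1 * (u * phi u)))) => [|i _].
    rewrite !big_split/= sumrN -!mulr_suml p1 pxi vE mul1r mul0r addr0.
    by congr (_ + _); ring.
  by rewrite /r; field.
have -> : \sum_i p i * Phi (u - xi i) - Phi (u / Num.sqrt (1 + v)) =
    \sum_i p i * r i -
    (Phi (u / Num.sqrt (1 + v)) - Phi u + v / 2 * (u * phi u)).
  by rewrite rE; ring.
apply: le_trans (ler_normB _ _) _.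
have s3 : 0 <= \sum_i p i * `|xi i| ^+ 3.
  by apply: sumr_ge0 => i _; rewrite mulr_ge0 ?exprn_ge0.
apply: (@le_trans _ _ (C * (\sum_i p i * `|xi i| ^+ 3) + D * v ^+ 2)).
  apply: lerD; last exact: S.
  rewrite mulr_sumr (le_trans (ler_norm_sum _ _ _))//; apply: ler_sum => i _.
  by rewrite normrM ger0_norm// mulrCA ler_wpM2l// -(normrN (xi i)); exact: T.
by rewrite mulrDl !mulrDr; nra.
Qed.

(** One exchange in the Lindeberg argument. Brownian scaling reduces it to unit
    time. *)
Lemma heat_step : exists2 C : R, 0 < C &
  forall m (p xi : 'I_m -> R) z t v, 0 < t -> (forall i, 0 <= p i) ->
    \sum_i p i = 1 -> \sum_i p i * xi i = 0 ->
    \sum_i p i * xi i ^+ 2 = v ->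
    `|\sum_i p i * Phi ((z - xi i) / Num.sqrt t) -
      Phi (z / Num.sqrt (t +
        v))| <= C * ((\sum_i p i * `|xi i| ^+ 3) / Num.sqrt t ^+ 3 +
          v ^+ 2 / t ^+ 2).
Proof.
have [C C0 H] := heat_step_time1.
exists C => // m p xi z t v t0 p0 p1 pxi vE.
have v0 : 0 <= v.
  by rewrite -vE; apply: sumr_ge0 => i _; rewrite mulr_ge0 ?sqr_ge0.
set s := Num.sqrt t; have s0 : 0 < s by rewrite sqrtr_gt0.
have s2 : s ^+ 2 = t by rewrite sqr_sqrtr// ltW.
have := H m p (fun i => xi i / s) (z / s) (v / t) p0 p1.
have -> : \sum_i p i * (xi i / s) = 0.
  by under eq_bigr do rewrite mulrA; rewrite -mulr_suml pxi mul0r.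
have -> : \sum_i p i * (xi i / s) ^+ 2 = v / t.
  by under eq_bigr do rewrite expr_div_n mulrA; rewrite -mulr_suml s2 vE.
have -> : \sum_i p i * `|xi i / s| ^+ 3 = (\sum_i p i * `|xi i| ^+ 3) / s ^+ 3.
  rewrite mulr_suml; apply: eq_bigr => i _.
  by rewrite normf_div (gtr0_norm s0) expr_div_n mulrA.
move/(_ erefl erefl) => /=.
have -> : z / s / Num.sqrt (1 + v / t) = z / Num.sqrt (t + v).
  rewrite -mulrA -invfM -sqrtrM; last exact: ltW.
  by rewrite mulrDr mulr1 mulrCA divff ?mulr1// gt_eqF.
rewrite expr_div_n.
by under eq_bigr do rewrite -mulrBl.
Qed.

Lemma std_normal_cdfE x : (Phi x)%:E = normal_prob 0 1 `]-oo, x].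
Proof. by rewrite fineK// fin_num_measure. Qed.

Lemma std_normal_cdf_ge0 x : 0 <= Phi x.
Proof. by rewrite -lee_fin std_normal_cdfE. Qed.

Lemma std_normal_cdf_le1 x : Phi x <= 1.
Proof. by rewrite -lee_fin std_normal_cdfE probability_le1. Qed.

Lemma std_normal_cdf_nd x y : x <= y -> Phi x <= Phi y.
Proof.
move=> xy; rewrite -lee_fin !std_normal_cdfE le_measure ?inE//.
exact: subitvPr.
Qed.

Let idR : measurableTypeR R -> R := idfun.

#[local] HB.instance Definition _ :=
  @isMeasurableFun.Build _ _ _ _ idR (@measurable_id _ _ setT).

Let N := normal_prob (0 : R) 1 : probability (measurableTypeR R) R.

Let cdf_idRE : cdf (idR : {RV N >-> R}) = EFin \o Phi.
Proof. by apply/funext => x /=; rewrite std_normal_cdfE. Qed.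

Lemma cvg_std_normal_cdfy1 : Phi x @[x --> +oo] --> (1 : R).
Proof.
by have := cvg_cdfy1 (idR : {RV N >-> R}); rewrite cdf_idRE => /fine_cvg.
Qed.

Lemma cvg_std_normal_cdfNy0 : Phi x @[x --> -oo] --> (0 : R).
Proof.
by have := cvg_cdfNy0 (idR : {RV N >-> R}); rewrite cdf_idRE => /fine_cvg.
Qed.

End gaussian.

(** * Inversions as a sum of independent minima *)

Section rank_in_set.
Context {n : nat}.
Implicit Types (D : {set 'I_n}) (c : 'I_n).

Definition rank_in D c : nat := #|[set d in D | (d < c)%N]%SET|.

Lemma rank_in_mono D c c' : (c <= c')%N -> (rank_in D c <= rank_in D c')%N.
Proof.
move=> cc'; apply/subset_leq_card/fintype.subsetP => d; rewrite !inE.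
by move=> /andP[-> /leq_trans]; apply.
Qed.

Lemma rank_in_lt D c : c \in D -> (rank_in D c < #|D|)%N.
Proof.
move=> cD; apply/proper_card/properP; split.
  by apply/fintype.subsetP => d; rewrite inE => /andP[].
by exists c => //; rewrite inE ltnn andbF.
Qed.

Lemma rank_in_mono_lt D c c' :
  c \in D -> (c < c')%N -> (rank_in D c < rank_in D c')%N.
Proof.
move=> cD cc'; apply/proper_card/properP; split.
  apply/fintype.subsetP => d; rewrite !inE => /andP[-> /ltn_trans]; exact.
by exists c; rewrite !inE ?ltnn ?andbF// cD.
Qed.

Lemma rank_in_inj D : {in D &, injective (rank_in D)}.
Proof.
move=> c c' cD c'D rr; apply/val_inj => /=.
case: (ltngtP c c') => // /rank_in_mono_lt.
  by move=> /(_ _ cD); rewrite rr ltnn.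
by move=> /(_ _ c'D); rewrite rr ltnn.
Qed.

(** The rank is a bijection from [D] to the initial segment of length [#|D|]. *)
Lemma sum_rank_in (V : nmodType) D (g : nat -> V) :
  \sum_(c in D) g (rank_in D c) = \sum_(y < #|D|) g y.
Proof.
case: (set_0Vmem D) => [->|[c0 c0D]]; first by rewrite big_set0 cards0 big_ord0.
have D0 : (0 < #|D|)%N by apply/card_gt0P; exists c0.
pose f c : 'I_#|D| := insubd (Ordinal D0) (rank_in D c).
have fE c : c \in D -> f c = rank_in D c :> nat.
  by move=> cD; rewrite val_insubd rank_in_lt.
have f_inj : {in D &, injective f}.
  by move=> c c' cD c'D /(congr1 val)/=; rewrite !fE//; exact: rank_in_inj.
have fD : (f @: D = [set: 'I_#|D|])%SET.
  by apply/eqP; rewrite eqEcard finset.subsetT cardsT card_ord card_in_imset/=.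
rewrite [RHS](_ : _ = \sum_(y in f @: D) g y); last first.
  by rewrite fD; apply: eq_bigl => y; rewrite inE.
by rewrite big_imset//=; apply: eq_bigr => c /fE ->.
Qed.

End rank_in_set.

Section minimum_law.
Context {R : realType}.

(** The probability that the minimum of [k] uniform samples of [{0, ..., m - 1}]
    is at least [y]. *)
Definition min_tail k m y : R := ((m - y)%:R / m%:R) ^+ k.
Definition min_pmf k m y : R := min_tail k m y - min_tail k m y.+1.
Definition min_mean k m (g : nat -> R) : R := \sum_(y < m) min_pmf k m y * g y.

Lemma sum_ord_geq m y (a : R) :
  \sum_(j < m) (if (y <= j)%N then a else 0) = (m - y)%:R * a.
Proof.
elim: m => [|m IH]; first by rewrite big_ord0 sub0n mul0r.
rewrite big_ord_recr/= IH; case: leqP => ym.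
  by rewrite subSn// -natr1 mulrDl mul1r.
by rewrite addr0; congr (_%:R * _); lia.
Qed.

(** The law of the rank of the minimum depends on [D] only through its size,
    which is what makes the successive ranks independent. The rank is monotone,
    so it is at least [y] at the minimum exactly when it is at least [y] at all
    the samples, and this probability is a product. *)
Lemma sum_min_samples n k (D : {set 'I_n}) (mn : {ffun 'I_k -> 'I_n} -> 'I_n)
    (g : nat -> R) : (0 < #|D|)%N ->
  (forall v, mn v \in codom v) -> (forall v i, (mn v <= v i)%N) ->
  \sum_(v : {ffun 'I_k -> 'I_n})
    (\prod_(i < k) if v i \in D then #|D|%:R^-1 else 0) * g (rank_in D (mn v)) =
  min_mean k #|D| g.
Proof.
move=> D0 mn_in mn_le; set m := #|D|.
pose q (v : {ffun 'I_k -> 'I_n}) : R :=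
  \prod_(i < k) if v i \in D then m%:R^-1 else 0.
have tailE y : \sum_(v : {ffun 'I_k -> 'I_n})
    q v * (y <= rank_in D (mn v))%N%:R = min_tail k m y.
  have -> : min_tail k m y = \prod_(i < k) \sum_(c : 'I_n)
      (if (c \in D) && (y <= rank_in D c)%N then m%:R^-1 else 0).
    rewrite /min_tail -[k in LHS](card_ord k) -prodr_const.
    apply: eq_bigr => i _; rewrite -big_mkcond/= big_mkcondr/=.
    rewrite (sum_rank_in D (fun j => if (y <= j)%N then m%:R^-1 else 0 : R)).
    by rewrite sum_ord_geq.
  rewrite bigA_distr_bigA/=; apply: eq_bigr => v _.
  have -> : (y <= rank_in D (mn v))%N = [forall i, (y <= rank_in D (v i))%N].
    apply/idP/forallP => [yr i|];
      first exact: leq_trans yr (rank_in_mono _ (mn_le _ _)).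
    by have /codomP[i ->] := mn_in v; apply.
  case: forallP => [yr|/forallP]; last first.
    rewrite negb_forall => /existsP[i /negbTE yi].
    by rewrite mulr0 (bigD1 i)//= yi andbF mul0r.
  by rewrite mulr1; apply: eq_bigr => i _; rewrite yr andbT.
rewrite /min_mean (eq_bigr (fun v => \sum_(y < m)
    (q v * (y <= rank_in D (mn v))%N%:R -
     q v * (y < rank_in D (mn v))%N%:R) * g y)).
  rewrite exchange_big/=; apply: eq_bigr => y _.
  by rewrite -mulr_suml sumrB !tailE.
move=> v _; have [q0|q0] := eqVneq (q v) 0.
  by rewrite -/(q v) q0 mul0r big1// => y _; rewrite !mul0r subrr mul0r.
have rm : (rank_in D (mn v) < m)%N.
  apply: rank_in_lt; have /codomP[i ->] := mn_in v.
  by apply: contraNT q0 => viD; rewrite /q (bigD1 i)//= (negbTE viD) mul0r.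
rewrite -/(q v) (bigD1 (Ordinal rm))//= leqnn ltnn mulr1 mulr0 subr0.
rewrite big1 ?addr0// => y yr; rewrite -mulrBr.
case: ltngtP => [yr'|yr'|yr']; rewrite ?subrr ?mulr0 ?mul0r//.
by move: yr; rewrite -val_eqE/= yr' eqxx.
Qed.

(** The expectation of [g (x + Y_1 + ... + Y_i)] for independent [Y_m], where
    [Y_m] is the minimum of [k] uniform samples of [{0, ..., m - 1}]. The
    recursion conditions on the largest index. *)
Fixpoint rank_mean k (i : nat) (g : nat -> R) (x : nat) : R :=
  if i is i'.+1 then min_mean k i (fun y => rank_mean k i' g (x + y)%N)
  else g x.

End minimum_law.

Lemma kcm_card_le n k (w : samples n k) t i : (kcm_card w t <= w t i)%N.
Proof.
rewrite /kcm_card /arg_min /extremum; case: pickP => [c /andP[_ /forallP h]|h].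
  by have /implyP := h (w t i); apply; exact: codom_f.
have [c cw cmin] := @arg_minnP _ (w t i) (mem (codom (w t))) val (codom_f _ _).
have /negP[] := negbT (h c); apply/andP; split=> //.
by apply/forallP => d; apply/implyP => /cmin.
Qed.

Lemma kcm_card_codom n k (w : samples n k) t : (0 < k)%N ->
  kcm_card w t \in codom (w t).
Proof. by case: k w => // k w _; exact: kcm_card_in. Qed.

Definition kcm_rank n k (w : samples n k) t :=
  rank_in (kcm_deck w t) (kcm_card w t).

(** The inversions whose larger card is drawn at time [t] correspond to the
    smaller cards of the deck at that time. *)
Lemma inversionsE n k (w : samples n k) : injective (kcm_card w) ->
  inversions (kcm_card w) = (\sum_t kcm_rank w t)%N.
Proof.
move=> inj; rewrite /inversions -sum1_card.
rewrite (eq_bigl (fun p : 'I_n * 'I_n => true && ((p.1 < p.2)%N &&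
  (kcm_card w p.2 < kcm_card w p.1)%N))) => [|p]; last by rewrite inE.
rewrite -(pair_big_dep xpredT (fun s t : 'I_n => (s < t)%N &&
  (kcm_card w t < kcm_card w s)%N) (fun _ _ => 1%N))/=.
apply: eq_bigr => s _; rewrite sum1dep_card /kcm_rank /rank_in.
rewrite -(card_imset _ inj); congr #|pred_of_set _|; apply/setP => c.
have [g gK Kg] := injF_bij inj; rewrite !inE.
apply/imsetP/andP => [[t]|[/forallP cD cs]].
  rewrite inE => /andP[st ts] ->; split=> //.
  apply/forallP => r; apply/implyP => rs; apply/eqP => /inj rt.
  by move: rs; rewrite rt ltnNge (ltnW st).
exists (g c) => //; rewrite inE Kg cs andbT ltnNge; apply/negP.
rewrite leq_eqVlt => /orP[/eqP/val_inj gs|gs].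
  by move: cs; rewrite -gs Kg ltnn.
by have := cD (g c); rewrite gs Kg eqxx.
Qed.

Section kcm_law.
Context {R : realType} {n k : nat}.
Implicit Types (w : samples n k) (t : 'I_n) (v : {ffun 'I_k -> 'I_n}).

Definition resample w t v : samples n k :=
  [ffun s => if s == t then v else w s].

Definition step_pmf w t v : R :=
  \prod_(i < k) (if v i \in kcm_deck w t then #|kcm_deck w t|%:R^-1 else 0).

Lemma kcm_card_resample w t v s : s != t ->
  kcm_card (resample w t v) s = kcm_card w s.
Proof. by move=> st; rewrite /kcm_card ffunE (negbTE st). Qed.

Lemma kcm_deck_resample w t v (s : 'I_n) : (s <= t)%N ->
  kcm_deck (resample w t v) s = kcm_deck w s.
Proof.
move=> st; apply/setP => c; rewrite !inE; apply: eq_forallb => r.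
case: ltnP => //= rs; rewrite kcm_card_resample//.
by rewrite -val_eqE /= neq_ltn (leq_trans rs st).
Qed.

Lemma sum_resample t (f : samples n k -> R) :
  \sum_w \sum_v f (resample w t v) = #|{ffun 'I_k -> 'I_n}|%:R * \sum_w f w.
Proof.
pose h (p : samples n k * {ffun 'I_k -> 'I_n}) := (resample p.1 t p.2, p.1 t).
have hK : involutive h.
  move=> [w v]; rewrite /h /=; congr pair; last by rewrite ffunE eqxx.
  by apply/ffunP => s; rewrite !ffunE; case: eqVneq => // ->.
rewrite pair_big/= (reindex_inj (inv_inj hK)) /=.
rewrite (eq_bigr (fun p => f p.1)) => [|[w v] _ /=]; last first.
  by congr f; have := hK (w, v); rewrite /h /= => -[].
rewrite -(pair_big xpredT xpredT (fun w v => f w)) /= mulr_sumr.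
by apply: eq_bigr => w _; rewrite sumr_const mulr_natl.
Qed.

Definition partial_pmf j w : R := \prod_(t < n | (t < j)%N) step_pmf w t (w t).

(** The mean of [f] when the first [j] times follow the procedure and the
    samples of the later times carry unit weight. The normalisation makes every
    [partial_mean j f] equal to the same multiple of the actual mean when [f]
    depends on the first [j] times only. *)
Definition partial_mean j (f : samples n k -> R) : R :=
  #|{ffun 'I_k -> 'I_n}|%:R ^+ j * \sum_w partial_pmf j w * f w.

(** Integrating out the samples of time [t]: averaging over resampling them
    leaves the sum over all outcomes unchanged up to the number of samples. *)
Lemma partial_mean_step t f :
  partial_mean t.+1 f =
  partial_mean t (fun w => \sum_v step_pmf w t v * f (resample w t v)).
Proof.
rewrite /partial_mean exprSr -mulrA -(sum_resample t); congr (_ * _).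
apply: eq_bigr => w _; rewrite mulr_sumr; apply: eq_bigr => v _.
rewrite mulrA; congr (_ * _).
rewrite /partial_pmf (bigD1 t)//= mulrC /step_pmf ffunE eqxx
  kcm_deck_resample//.
congr (_ * _); apply: eq_big => [s|s /andP[sj st]].
  by rewrite ltnS -val_eqE /= andbC -ltn_neqAle.
by rewrite kcm_deck_resample// ffunE (negbTE st).
Qed.

(** Where the weight does not vanish, the cards drawn so far are distinct. *)
Lemma card_kcm_deck t w : (0 < k)%N -> partial_pmf t w != 0 ->
  #|kcm_deck w t| = (n - t)%N.
Proof.
move=> k0 w0; pose A := [set s : 'I_n | (s < t)%N]%SET.
have inD (s : 'I_n) : (s < t)%N -> kcm_card w s \in kcm_deck w s.
  move=> st; have /codomP[i ->] := kcm_card_codom w s k0.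
  apply: contraNT w0 => wD; rewrite /partial_pmf (bigD1 s)//=.
  by rewrite /step_pmf (bigD1 i)//= (negbTE wD) !mul0r.
have neC (r s : 'I_n) : (r < s)%N -> (s < t)%N -> kcm_card w r != kcm_card w s.
  by move=> rs /inD; rewrite inE => /forallP/(_ r); rewrite rs.
have injC : {in A &, injective (kcm_card w)}.
  move=> r s; rewrite !inE => rt st Crs; apply/val_inj => /=.
  case: (ltngtP r s) => // [/neC/(_ st)|/neC/(_ rt)]; by rewrite Crs eqxx.
have -> : kcm_deck w t = (~: (kcm_card w @: A))%SET.
  apply/setP => c; rewrite !inE; apply/forallP/idP => [h|/negP h s].
    apply/imsetP => -[s]; rewrite inE => st cs.
    by have := h s; rewrite st cs eqxx.
  apply/implyP => st; apply/eqP => sc; apply: h.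
  by apply/imsetP; exists s; rewrite ?inE.
rewrite cardsCs finset.setCK card_in_imset// card_ord; congr (_ - _)%N.
rewrite -sum1dep_card -(big_ord_widen n (fun=> 1%N)) ?(ltnW (ltn_ord t))//.
by rewrite sum1_card card_ord.
Qed.

Definition rank_sum j w : nat := (\sum_(t < n | (t < j)%N) kcm_rank w t)%N.

Lemma partial_mean_rank_step t (g : nat -> R) : (0 < k)%N ->
  partial_mean t.+1 (fun w => g (rank_sum t.+1 w)) =
  partial_mean t (fun w =>
    min_mean k (n - t) (fun y => g (rank_sum t w + y)%N)).
Proof.
move=> k0; rewrite partial_mean_step /partial_mean; congr (_ * _).
apply: eq_bigr => w _.
have [->|w0] := eqVneq (partial_pmf t w) 0; first by rewrite !mul0r.
congr (_ * _); have cD := card_kcm_deck k0 w0.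
rewrite -cD -(@sum_min_samples _ _ _ _ (fun v => kcm_card (resample w t v) t)).
- apply: eq_bigr => v _; congr (_ * g _).
  rewrite /rank_sum (bigD1 t)//= addnC; congr (_ + _)%N.
    apply: eq_big => [s|s /andP[sj st]].
      by rewrite ltnS -val_eqE /= andbC -ltn_neqAle.
    by rewrite /kcm_rank kcm_deck_resample// kcm_card_resample.
  by rewrite /kcm_rank kcm_deck_resample.
- by rewrite cD subn_gt0.
- by move=> v; have := kcm_card_codom (resample w t v) t k0; rewrite ffunE eqxx.
- by move=> v i; have := kcm_card_le (resample w t v) t i; rewrite ffunE eqxx.
Qed.

(** The samples are integrated out from the last time, when one card is left, to
    the first one, when [n] cards are left. *)
Lemma sum_kcm_inversions (g : nat -> R) : (0 < k)%N ->
  \sum_(w : samples n k) kcm_pmf w * g (inversions (kcm_card w)) =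
  rank_mean k n g 0.
Proof.
move=> k0; pose V : R := #|{ffun 'I_k -> 'I_n}|%:R ^+ n.
have V0 : V != 0.
  rewrite expf_eq0 pnatr_eq0 card_ffun !card_ord expn_eq0.
  by case: posnP => //= n0; rewrite gtn_eqF.
apply: (mulfI V0).
transitivity (partial_mean n (fun w => g (rank_sum n w))).
  rewrite /partial_mean -/V; congr (_ * _); apply: eq_bigr => w _.
  have -> : partial_pmf n w = kcm_pmf w by apply: eq_bigl => t; rewrite ltn_ord.
  have [->|w0] := eqVneq (kcm_pmf w : R) 0; first by rewrite !mul0r.
  have inj : injective (kcm_card w).
    clear -k0 w0; case: k k0 w w0 => // k' _ w; exact: kcm_card_inj.
  congr (_ * g _); rewrite inversionsE//.
  by apply: eq_bigl => t; rewrite ltn_ord.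
have H i : (i <= n)%N -> partial_mean n (fun w => g (rank_sum n w)) =
    partial_mean (n - i) (fun w => rank_mean k i g (rank_sum (n - i) w)).
  elim: i => [|i IH] i_n; first by rewrite subn0.
  rewrite (IH (ltnW i_n)).
  have ti : (n - i.+1 < n)%N by lia.
  have := @partial_mean_rank_step (Ordinal ti) (rank_mean k i g) k0.
  rewrite /= (_ : (n - i.+1).+1 = n - i)%N; last by lia.
  by rewrite subKn.
rewrite (H n)// subnn /partial_mean expr0 mul1r.
rewrite (eq_bigr (fun=> rank_mean k n g 0)) => [|w _].
  have cV : #|{: samples n k}| = (#|{ffun 'I_k -> 'I_n}| ^ n)%N.
    by rewrite card_ffun card_ord.
  by rewrite sumr_const cV -[LHS]mulr_natl natrX.
by rewrite /partial_pmf /rank_sum !big_pred0// mul1r.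
Qed.

End kcm_law.

(** * Moments of the minimum of uniform samples *)

Section minimum_moments.
Context {R : realType}.
Implicit Types (k m y r : nat).

Lemma min_tail0 k m : (0 < m)%N -> min_tail k m 0 = 1 :> R.
Proof.
by move=> m0; rewrite /min_tail subn0 divff ?expr1n// pnatr_eq0 -lt0n.
Qed.

Lemma min_tail_max k m : (0 < k)%N -> min_tail k m m = 0 :> R.
Proof. by move=> k0; rewrite /min_tail subnn mul0r expr0n eqn0Ngt k0. Qed.

Lemma min_pmf_ge0 k m y : 0 <= min_pmf k m y :> R.
Proof.
rewrite subr_ge0 lerXn2r ?nnegrE ?divr_ge0// ler_wpM2r ?invr_ge0// ler_nat.
by rewrite leq_sub2l.
Qed.

(** Summation by parts, which turns point masses into tails. *)
Lemma min_mean_abel k m (c : nat -> R) :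
  min_mean k m c = min_tail k m 0 * c 0%N - min_tail k m m * c m +
    \sum_(y < m) min_tail k m y.+1 * (c y.+1 - c y).
Proof.
rewrite /min_mean; set T := min_tail k m.
have : forall N, \sum_(y < N) (T y - T y.+1) * c y = T 0%N * c 0%N - T N * c N +
    \sum_(y < N) T y.+1 * (c y.+1 - c y).
  elim=> [|N IH]; first by rewrite !big_ord0 subrr addr0.
  by rewrite !big_ord_recr/= IH; ring.
exact.
Qed.

Lemma sum_min_pmf k m : (0 < k)%N -> (0 < m)%N ->
  \sum_(y < m) min_pmf k m y = 1 :> R.
Proof.
move=> k0 m0; have := min_mean_abel k m (fun=> 1).
rewrite min_tail0// min_tail_max// big1 => [|y _]; last by rewrite subrr mulr0.
by rewrite mul0r subr0 addr0 mulr1 => <-; apply: eq_bigr => y _; rewrite mulr1.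
Qed.

Lemma min_mean_le k m (g h : nat -> R) : (forall y, g y <= h y) ->
  min_mean k m g <= min_mean k m h.
Proof.
by move=> gh; apply: ler_sum => y _; rewrite ler_wpM2l// min_pmf_ge0.
Qed.

Lemma min_meanD k m (g h : nat -> R) :
  min_mean k m (fun y => g y + h y) = min_mean k m g + min_mean k m h.
Proof. by rewrite -big_split; apply: eq_bigr => y _; rewrite mulrDr. Qed.

Lemma min_meanZ k m a (g : nat -> R) :
  min_mean k m (fun y => a * g y) = a * min_mean k m g.
Proof.
by rewrite /min_mean mulr_sumr; apply: eq_bigr => y _; rewrite mulrCA.
Qed.

Lemma min_mean_cst k m a : (0 < k)%N -> (0 < m)%N ->
  min_mean k m (fun=> a) = a :> R.
Proof. by move=> k0 m0; rewrite /min_mean -mulr_suml sum_min_pmf// mul1r. Qed.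

Lemma eq_min_mean k m (g h : nat -> R) : g =1 h ->
  min_mean k m g = min_mean k m h.
Proof. by move=> gh; apply: eq_bigr => y _; rewrite gh. Qed.

(** With [a = (m - y) / m] and [b = a - 1 / m], this is [a ^ k.+1 - b ^ k.+1 >=
    k.+1 * b ^ k * (a - b)]. *)
Lemma min_tail_step k m y : (y < m)%N ->
  min_tail k m y.+1 <= m%:R / k.+1%:R * min_pmf k.+1 m y :> R.
Proof.
move=> ym; have m0 : 0 < m%:R :> R by rewrite ltr0n (leq_ltn_trans _ ym).
rewrite mulrAC ler_pdivlMr ?ltr0n// /min_pmf /min_tail.
set a : R := (m - y)%:R / _; set b : R := (m - y.+1)%:R / _.
have ab : a - b = m%:R^-1.
  rewrite /a /b -mulrBl !natrB// ?(ltnW ym)// -natr1.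
  by rewrite -[RHS]mul1r; congr (_ * _); ring.
have b0 : 0 <= b by rewrite divr_ge0.
have ba : b <= a by rewrite -subr_ge0 ab invr_ge0 ltW.
rewrite subrXX ab mulrA divff ?mul1r ?gt_eqF//.
rewrite mulr_natr -[k.+1 in X in X <= _](card_ord k.+1) -sumr_const.
apply: ler_sum => i _; rewrite -[X in b ^+ X](@subnK i k) ?exprD; last first.
  by rewrite -ltnS ltn_ord.
by rewrite ler_wpM2r ?exprn_ge0// lerXn2r ?nnegrE// (le_trans b0).
Qed.

(** Pascal's rule makes ['C(y, r)] the increment of ['C(y, r.+1)], and the tail
    for [k] samples is bounded by the point mass for [k.+1] samples. *)
Lemma min_binomial_moment_step k m r : (0 < k)%N ->
  min_mean k m (fun y => 'C(y, r.+1)%:R) <=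
  m%:R / k.+1%:R * min_mean k.+1 m (fun y => 'C(y, r)%:R) :> R.
Proof.
move=> k0; rewrite min_mean_abel min_tail_max// mul0r subr0 bin0n mulr0 add0r.
rewrite mulr_sumr; apply: ler_sum => y _;
  rewrite mulrA binS natrD addrAC subrr add0r.
by rewrite ler_wpM2r// min_tail_step.
Qed.

Lemma min_binomial_moment k m r : (0 < k)%N -> (0 < m)%N ->
  min_mean k m (fun y => 'C(y, r)%:R) <= (m%:R / k%:R) ^+ r :> R.
Proof.
move=> + m0; elim: r k => [|r IH] k k0.
  by rewrite (eq_min_mean _ _ (h := fun=> 1)) ?min_mean_cst// => y;
    rewrite bin0.
apply: le_trans (min_binomial_moment_step _ _ k0) _; rewrite exprS.
have kk : m%:R / k.+1%:R <= m%:R / k%:R :> R.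
  by rewrite ler_pM2l ?ltr0n// lef_pV2 ?posrE ?ltr0n// ler_nat.
apply: ler_pM => //.
  by apply: sumr_ge0 => y _; rewrite mulr_ge0// min_pmf_ge0.
by apply: le_trans (IH _ _) _ => //; rewrite lerXn2r ?nnegrE ?divr_ge0.
Qed.

Lemma sqr_bin y : y%:R ^+ 2 = 2 * 'C(y, 2)%:R + 'C(y, 1)%:R :> R.
Proof.
elim: y => [|y IH]; first by rewrite !bin0n expr0n/= mulr0 addr0.
by rewrite !binS !natrD bin0 bin1 in IH *; rewrite -[y.+1%:R]natr1 sqrrD IH;
  ring.
Qed.

Lemma cube_bin y :
  y%:R ^+ 3 = 6 * 'C(y, 3)%:R + 6 * 'C(y, 2)%:R + 'C(y, 1)%:R :> R.
Proof.
elim: y => [|y IH]; first by rewrite !bin0n expr0n/= !mulr0 !addr0.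
have := sqr_bin y; rewrite !binS !natrD bin0 bin1 in IH *; move: IH.
rewrite -[y.+1%:R]natr1 => IH sq.
have -> : (y%:R + 1) ^+ 3 =
    y%:R ^+ 3 + 3 * y%:R ^+ 2 + 3 * y%:R + 1 :> R by ring.
by rewrite IH sq; ring.
Qed.

Definition min_mu k m : R := min_mean k m (fun y => y%:R).
Definition min_var k m : R := min_mean k m (fun y => (y%:R - min_mu k m) ^+ 2).

Lemma min_mu_ge0 k m : 0 <= min_mu k m.
Proof. by apply: sumr_ge0 => y _; rewrite mulr_ge0// min_pmf_ge0. Qed.

Lemma min_var_ge0 k m : 0 <= min_var k m.
Proof. by apply: sumr_ge0 => y _; rewrite mulr_ge0 ?sqr_ge0 ?min_pmf_ge0. Qed.

Section bounds.
Variables (k m : nat) (b : R).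
Hypotheses (k0 : (0 < k)%N) (m0 : (0 < m)%N).
Hypotheses (b1 : 1 <= b) (mkb : m%:R / k%:R <= b).

Let moment_le r : min_mean k m (fun y => 'C(y, r)%:R) <= b ^+ r.
Proof.
apply: le_trans (min_binomial_moment _ k0 m0) _.
by rewrite lerXn2r ?nnegrE ?divr_ge0// (le_trans _ b1).
Qed.

Lemma min_mu_le : min_mu k m <= b.
Proof.
have := moment_le 1; rewrite expr1; apply: le_trans.
by rewrite (eq_min_mean _ _ (h := fun y => y%:R))// => y; rewrite bin1.
Qed.

Lemma min_mean_centered : min_mean k m (fun y => y%:R - min_mu k m) = 0.
Proof. by rewrite min_meanD min_mean_cst// subrr. Qed.

Lemma min_var_le : min_var k m <= 3 * b ^+ 2.
Proof.
have E : min_var k m + min_mu k m ^+ 2 =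
    2 * min_mean k m (fun y => 'C(y, 2)%:R) +
    min_mean k m (fun y => 'C(y, 1)%:R).
  rewrite -min_meanZ -min_meanD -[in LHS](min_mean_cst (_ ^+ 2) k0 m0)
    -min_meanD.
  rewrite (eq_min_mean _ _ (h := fun y => (2 * 'C(y, 2)%:R + 'C(y, 1)%:R) +
    (- (2 * min_mu k m)) * (y%:R - min_mu k m))) => [|y].
    by rewrite [LHS]min_meanD min_meanZ min_mean_centered mulr0 addr0.
  by rewrite -sqr_bin; ring.
have := moment_le 2; have := moment_le 1; have := sqr_ge0 (min_mu k m).
rewrite expr1; have : b <= b ^+ 2 by rewrite expr2 ler_peMr// (le_trans _ b1).
lra.
Qed.

Lemma min_third_moment_le :
  min_mean k m (fun y => `|y%:R - min_mu k m| ^+ 3) <= 14 * b ^+ 3.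
Proof.
have b0 : 0 <= b by rewrite (le_trans _ b1).
have mu3 : min_mu k m ^+ 3 <= b ^+ 3.
  by rewrite lerXn2r ?nnegrE ?min_mu_ge0// min_mu_le.
apply: (@le_trans _ _ (min_mean k m (fun y =>
    (6 * 'C(y, 3)%:R + 6 * 'C(y, 2)%:R) + 'C(y, 1)%:R + min_mu k m ^+ 3))).
  apply: min_mean_le => y; rewrite -cube_bin.
  have y0 : 0 <= y%:R :> R by [].
  have [ym|my] := leP (min_mu k m) y%:R.
    rewrite ger0_norm ?subr_ge0// (@le_trans _ _ (y%:R ^+ 3))//.
      by rewrite lerXn2r ?nnegrE ?subr_ge0// gerBl min_mu_ge0.
    by rewrite lerDl exprn_ge0// min_mu_ge0.
  rewrite ltr0_norm ?subr_lt0// opprB (@le_trans _ _ (min_mu k m ^+ 3))//.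
    by rewrite lerXn2r ?nnegrE ?subr_ge0 ?min_mu_ge0// ?gerBl// ltW.
  by rewrite lerDr exprn_ge0.
rewrite !min_meanD !min_meanZ min_mean_cst//.
have := moment_le 3; have := moment_le 2; have := moment_le 1.
have b12 : b <= b ^+ 2 by rewrite expr2 ler_peMr.
have b23 : b ^+ 2 <= b ^+ 3 by rewrite [leRHS]exprS ler_peMl// sqr_ge0.
rewrite expr1; lra.
Qed.

End bounds.

(** With [b = m / k], the mean is at most [b], whereas the minimum exceeds [2 *
    b] with a probability bounded from below: the tail at [3 * b] is [(1 - 3 /
    k) ^ k >= expR (- 6)]. *)
Lemma min_var_ge k m : (6 <= k)%N -> (k <= m)%N ->
  expR (- 6) * (m%:R / k%:R) ^+ 2 <= min_var k m.
Proof.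
move=> k6 km; have k0 : (0 < k)%N by lia.
have m0 : (0 < m)%N by lia.
have kR : 0 < k%:R :> R by rewrite ltr0n.
have mR : 0 < m%:R :> R by rewrite ltr0n.
have k6R : 6 <= k%:R :> R by rewrite ler_nat.
set b : R := m%:R / k%:R.
have b1 : 1 <= b by rewrite ler_pdivlMr// mul1r ler_nat.
have mu_b : min_mu k m <= b by exact: min_mu_le.
have mE : m%:R = b * k%:R by rewrite divfK// gt_eqF.
have [y0 y0b y0b'] : exists2 y0 : nat, 2 * b <= y0%:R & y0%:R <= 3 * b.
  exists (Num.truncn (2 * b)).+1; first by rewrite ltW// truncnS_gt.
  rewrite -natr1; have := @truncn_le R (2 * b).
  by rewrite (_ : 0 <= 2 * b); lra.
have y0m : (y0 <= m)%N by rewrite -(ler_nat R); nra.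
have tail_ge : expR (- 6) <= min_tail k m y0 :> R.
  rewrite [X in expR X](_ : _ = k%:R * (- (6 / k%:R))); last first.
    by rewrite mulrC mulNr divfK// gt_eqF.
  rewrite expRM_natl /min_tail lerXn2r ?nnegrE ?expR_ge0 ?divr_ge0//.
  apply: (@le_trans _ _ (1 - 3 / k%:R)).
    have x6 : 1 / k%:R <= 6^-1 :> R by rewrite div1r lef_pV2 ?posrE.
    have x0 : 0 < 1 / k%:R :> R by rewrite divr_gt0.
    rewrite -[6 / _]mulr1 -[3 / _]mulr1 -!mulrA [k%:R^-1 * 1]mulrC.
    move: (1 / k%:R) x6 x0 => x x6 x0.
    (* with [x = 1 / k], [(1 - 3 * x) * (1 + 6 * x) >= 1] as [x <= 1 / 6] *)
    rewrite expRN -[leLHS]mul1r ler_pdivrMr ?expR_gt0//.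
    apply: (@le_trans _ _ ((1 - 3 * x) * (1 + 6 * x))); first by nra.
    by rewrite ler_wpM2l ?expR_ge1Dx//; lra.
  rewrite natrB// mulrBl divff ?gt_eqF// lerD2l lerN2 ler_pdivrMr//.
  by rewrite mulrAC -mulrA -/b.
apply: (@le_trans _ _ (min_mean k m (fun y => b ^+ 2 * (y0 <= y)%N%:R))).
  rewrite min_meanZ mulrC ler_wpM2l ?sqr_ge0//.
  have y00 : (0 < y0)%N by rewrite -(ltr_nat R); lra.
  rewrite min_mean_abel min_tail_max// mul0r subr0 leqNgt y00 mulr0 add0r.
  have y0m' : (y0.-1 < m)%N by lia.
  rewrite (bigD1 (Ordinal y0m'))//= prednK// leqnn.
  rewrite (_ : (y0 <= y0.-1)%N = false) ?subr0 ?mulr1 ?big1 ?addr0//;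
    last by lia.
  move=> y; rewrite -val_eqE/= => yy0.
  have -> : (y0 <= y.+1)%N = (y0 <= y)%N by lia.
  by rewrite subrr mulr0.
apply: min_mean_le => y; case: leqP => y0y; last by rewrite mulr0 sqr_ge0.
have y0yR : y0%:R <= y%:R :> R by rewrite ler_nat.
by rewrite mulr1 lerXn2r ?nnegrE//; lra.
Qed.

End minimum_moments.

(** * Exchange with Gaussian variables *)

Section sum_of_minima.
Context {R : realType}.
Variable k : nat.
Implicit Types (g h : nat -> R) (i n x : nat).
Local Notation Phi := (@std_normal_cdf R).

Definition sum_mu n : R := \sum_(j < n) min_mu k j.+1.
Definition sum_var n : R := \sum_(j < n) min_var k j.+1.

Lemma sum_var_ge0 n : 0 <= sum_var n.
Proof. by apply: sumr_ge0 => j _; exact: min_var_ge0. Qed.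

(** For the indices between [n / 2] and [n], the lower bound of [min_var_ge] is
    at least a quarter of its value at [n]. *)
Lemma sum_var_ge n : (6 <= k)%N -> (k.*2 <= n)%N ->
  expR (- 6) / 8 * n%:R * (n%:R / k%:R) ^+ 2 <= sum_var n.
Proof.
move=> k6 kn; pose h := n./2; have k0 : (0 < k)%N by lia.
have kR : 0 < k%:R :> R by rewrite ltr0n.
have nh : n%:R <= 2 * (n - h)%:R :> R.
  by rewrite -natrM ler_nat /h; lia.
pose c : R := expR (- 6) * (n%:R / k%:R / 2) ^+ 2.
have c0 : 0 <= c by rewrite mulr_ge0 ?expR_ge0 ?sqr_ge0.
apply: (@le_trans _ _ ((n - h)%:R * c)).
  have -> : expR (- 6) / 8 * n%:R * (n%:R / k%:R) ^+ 2 = n%:R / 2 * c :> R.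
    by rewrite /c; field; rewrite gt_eqF.
  by rewrite ler_wpM2r// ler_pdivrMr// mulrC.
rewrite -sum_ord_geq; apply: ler_sum => j _; case: leqP => hj;
  last exact: min_var_ge0.
have jn := ltn_ord j.
apply: le_trans (min_var_ge k6 _); last by rewrite /h in hj; lia.
rewrite ler_wpM2l ?expR_ge0// lerXn2r ?nnegrE ?divr_ge0//.
rewrite mulrAC ler_wpM2r ?invr_ge0 ?ler0n// ler_pdivrMr// mulrC -natrM ler_nat.
by rewrite /h in hj; lia.
Qed.

Lemma eq_rank_mean i g h x : g =1 h -> rank_mean k i g x = rank_mean k i h x.
Proof. by move=> gh; congr rank_mean; apply/funext. Qed.

Lemma rank_mean_le i g h x : (forall y, g y <= h y) ->
  rank_mean k i g x <= rank_mean k i h x.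
Proof.
by move=> gh; elim: i x => [|i IH] x //=; apply: min_mean_le => y; exact: IH.
Qed.

Lemma rank_meanD i g h x :
  rank_mean k i (fun y => g y + h y) x = rank_mean k i g x + rank_mean k i h x.
Proof.
elim: i x => [|i IH] x //=; rewrite -min_meanD; apply: eq_min_mean => y.
exact: IH.
Qed.

Hypothesis k0 : (0 < k)%N.

Lemma rank_mean_cst i a x : rank_mean k i (fun=> a) x = a :> R.
Proof.
elim: i x => [|i IH] x //=; rewrite (eq_min_mean _ _ (h := fun=> a)) => [|y].
  by rewrite min_mean_cst.
exact: IH.
Qed.

Lemma rank_mean_id i x : rank_mean k i (fun y => y%:R) x = x%:R + sum_mu i.
Proof.
elim: i x => [|i IH] x /=; first by rewrite /sum_mu big_ord0 addr0.
rewrite (eq_min_mean _ _ (h := fun y => (x%:R + sum_mu i) + y%:R)) => [|y].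
  by rewrite min_meanD min_mean_cst// /sum_mu big_ord_recr/= addrA.
by rewrite IH natrD addrAC.
Qed.

Lemma rank_mean_sqr i c x :
  rank_mean k i (fun y => (y%:R - c) ^+ 2) x =
  sum_var i + (x%:R + sum_mu i - c) ^+ 2.
Proof.
elim: i x => [|i IH] x /=;
  first by rewrite /sum_var /sum_mu !big_ord0 add0r addr0.
set e := x%:R + sum_mu i.+1 - c.
rewrite (eq_min_mean _ _ (h := fun y => (sum_var i + e ^+ 2) +
  ((y%:R - min_mu k i.+1) ^+ 2 + 2 * e * (y%:R - min_mu k i.+1)))) => [|y].
  rewrite min_meanD min_mean_cst// min_meanD min_meanZ min_mean_centered//
    mulr0 addr0.
  by rewrite -/(min_var _ _) /sum_var [in RHS]big_ord_recr/= addrAC.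
by rewrite IH natrD /e /sum_mu big_ord_recr/=; ring.
Qed.

End sum_of_minima.

Section lindeberg.
Context {R : realType}.
Local Notation Phi := (@std_normal_cdf R).

(** Lindeberg's exchange argument: the errors of [heat_step] add up, since
    averaging over one more [Y_m] does not increase the error made so far. *)
Lemma rank_mean_heat_le : exists2 C : R, 0 < C &
  forall k i n x (a b t : R), (0 < k)%N -> (i <= n)%N ->
    1 <= b -> n%:R / k%:R <= b -> 0 < t ->
  `|rank_mean k i (fun y => Phi ((a - y%:R) / Num.sqrt t)) x -
    Phi ((a - x%:R - sum_mu k i) / Num.sqrt (t + sum_var k i))| <=
  i%:R * (C * (14 * b ^+ 3 / Num.sqrt t ^+ 3 + 9 * b ^+ 4 / t ^+ 2)).
Proof.
have [C C0 step] := @heat_step R.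
exists C => // k i n x a b t k0 + b1 nb t0;
  have b0 : 0 <= b by rewrite (le_trans _ b1).
elim: i x => [|i IH] x i_n /=.
  by rewrite /sum_mu /sum_var !big_ord0 mul0r subr0 addr0 subrr normr0.
set e := C * _.
pose u := t + sum_var k i; have tu : t <= u by rewrite lerDl sum_var_ge0.
have u0 : 0 < u by rewrite (lt_le_trans t0).
have i1b : i.+1%:R / k%:R <= b.
  by apply: le_trans nb; rewrite ler_wpM2r// ler_nat.
pose z := a - x%:R - sum_mu k i.+1.
pose xi y : R := y%:R - min_mu k i.+1.
have := step i.+1 (fun y => min_pmf k i.+1 y) (fun y => xi y) z u
  (min_var k i.+1) u0 (fun y => min_pmf_ge0 k i.+1 y)
  (sum_min_pmf k0 (ltn0Sn i))
  (min_mean_centered k0 (ltn0Sn i)) erefl.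
have -> : u + min_var k i.+1 = t + sum_var k i.+1.
  by rewrite /u /sum_var big_ord_recr/= addrA.
rewrite -/z => {}step.
have -> : i.+1%:R * e = i%:R * e + e by rewrite -[i.+1%:R]natr1 mulrDl mul1r.
set A := min_mean _ _ _; set B := (X in `|X - _| <= _) in step.
have AB : `|A - B| <= i%:R * e.
  rewrite /A /B /min_mean -sumrB (le_trans (ler_norm_sum _ _ _))//.
  have -> : i%:R * e = \sum_(y < i.+1) min_pmf k i.+1 y * (i%:R * e).
    by rewrite -mulr_suml sum_min_pmf// mul1r.
  apply: ler_sum => y _; rewrite -mulrBr normrM ger0_norm ?min_pmf_ge0//.
  rewrite ler_wpM2l ?min_pmf_ge0//.
  have := IH (x + y)%N (ltnW i_n); rewrite -/u.
  have -> // : a - (x + y)%:R - sum_mu k i = z - xi y.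
  by rewrite /z /xi natrD /sum_mu big_ord_recr/=; ring.
have -> : A - Phi (z / Num.sqrt (t + sum_var k i.+1)) =
    (A - B) + (B - Phi (z / Num.sqrt (t + sum_var k i.+1))).
  by rewrite addrA subrK.
apply: le_trans (ler_normD _ _) _; apply: lerD => //.
apply: le_trans step _; rewrite ler_pM2l//.
have st0 : 0 < Num.sqrt t by rewrite sqrtr_gt0.
have su0 : 0 < Num.sqrt u by rewrite sqrtr_gt0.
apply: lerD.
  apply: ler_pM.
  - by apply: sumr_ge0 => y _; rewrite mulr_ge0 ?min_pmf_ge0 ?exprn_ge0.
  - by rewrite invr_ge0 exprn_ge0 ?sqrtr_ge0.
  - exact: min_third_moment_le.
  - by rewrite lef_pV2 ?posrE ?exprn_gt0// lerXn2r ?nnegrE ?sqrtr_ge0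
    ?ler_wsqrtr.
apply: ler_pM; rewrite ?sqr_ge0 ?invr_ge0 ?sqr_ge0//.
  have -> : 9 * b ^+ 4 = (3 * b ^+ 2) ^+ 2 by ring.
  rewrite lerXn2r ?nnegrE ?min_var_ge0 ?mulr_ge0 ?sqr_ge0//.
  exact: min_var_le.
by rewrite lef_pV2 ?posrE ?exprn_gt0// lerXn2r// nnegrE ltW//.
Qed.

End lindeberg.

(** * Convergence of the distribution functions *)

Section kcm_distribution.
Context {R : realType} (n k : nat).
Local Notation P := (kcm_prob R n k).

(** Nonnegativity allows to split the integral over the singletons without any
    integrability condition. *)
Lemma kcm_expectation (f : samples n k -> R) : (forall w, 0 <= f w) ->
  ('E_P[f] = (\sum_w kcm_pmf w * f w)%:E)%E.
Proof.
move=> f0; rewrite unlock.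
have E : [set: samples n k] =
    \big[setU/set0]_(w <- index_enum (samples n k)) [set w].
  by apply/seteqP; split=> // w _; rewrite (bigD1 w)//=; left.
rewrite E ge0_integral_bigsetU//=; last 3 first.
- exact: index_enum_uniq.
- by move=> w w' _ _ [x [-> ->]].
- by move=> x _; rewrite lee_fin.
rewrite -sumEFin; apply: eq_bigr => w _.
rewrite (eq_integral (fun=> (f w)%:E)) => [|x]; last by rewrite inE => ->.
have Pw : kcm_prob R n k [set w] = (kcm_pmf w)%:E.
  by rewrite /kcm_prob esum_set1// lee_fin kcm_pmf_ge0.
by rewrite integral_cst//= [X in (_ * X)%E]Pw -EFinM mulrC.
Qed.

Hypothesis k0 : (0 < k)%N.

Lemma kcm_expectation_inv (g : nat -> R) : (forall y, 0 <= g y) ->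
  ('E_P[fun w => g (inversions (kcm_card w))] = (rank_mean k n g 0)%:E)%E.
Proof. by move=> g0; rewrite kcm_expectation// sum_kcm_inversions. Qed.

Lemma mean_kcm_inv : fine ('E_P[kcm_inv R n k])%E = sum_mu k n.
Proof.
by rewrite (kcm_expectation_inv (g := fun y => y%:R))//= rank_mean_id// add0r.
Qed.

Lemma variance_kcm_inv : fine ('V_P[kcm_inv R n k])%E = sum_var k n.
Proof.
rewrite /variance [@covariance]unlock mean_kcm_inv.
rewrite (_ : (_ * _)%R = fun w =>
  (((inversions (kcm_card w))%:R - sum_mu k n) ^+ 2 : R)).
  rewrite (kcm_expectation_inv (g := fun y =>
    (y%:R - sum_mu k n) ^+ 2))/= => [|y].
    by rewrite rank_mean_sqr// add0r subrr expr0n addr0.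
  exact: sqr_ge0.
by apply/funext => w; rewrite !fctE expr2.
Qed.

Lemma cdf_std_kcm_inv x :
  cdf (std_kcm_inv R n k : {RV P >-> R}) x =
  (rank_mean k n (fun y =>
     ((y%:R - sum_mu k n) / Num.sqrt (sum_var k n) <= x)%R%:R) 0)%:E.
Proof.
rewrite -kcm_expectation_inv// /cdf /distribution /pushforward.
rewrite -expectation_indic//; congr expectation; apply/funext => w.
rewrite indicE; congr ((nat_of_bool _)%:R); apply/idP/idP;
  rewrite inE/= in_itv/= /std_kcm_inv.
  by rewrite mean_kcm_inv variance_kcm_inv.
by rewrite mean_kcm_inv variance_kcm_inv.
Qed.

End kcm_distribution.

Section smoothing.
Context {R : realType}.
Local Notation Phi := (@std_normal_cdf R).
(* the constant of [sum_var_ge] *)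
Local Notation c := (expR (- 6) / 8 : R).

(** The bound is of order [n ^ (- 1 / 2)] for fixed [e]. It is uniform in [k]
    because the scale [b = n / k] cancels between the third moments and the
    variance. *)
Lemma rank_mean_smooth_le : exists2 C : R, 0 < C &
  forall k n (a e : R), (6 <= k)%N -> (k.*2 <= n)%N -> 0 < e ->
  1 <= Num.sqrt (e * c * n%:R) ->
  `|rank_mean k n (fun y =>
       Phi ((a - (y%:R - sum_mu k n) / Num.sqrt (sum_var k n)) / Num.sqrt e)) 0
         - Phi (a / Num.sqrt (1 + e))| <=
  C / (e * c * Num.sqrt (e * c * n%:R)).
Proof.
have c0 : 0 < c by rewrite divr_gt0 ?expR_gt0.
have [C C0 HC] := @rank_mean_heat_le R.
exists (23 * C) => [|k n a e k6 kn e0 q1]; first by rewrite mulr_gt0.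
have k0 : (0 < k)%N by lia.
have kR : 0 < k%:R :> R by rewrite ltr0n.
have nR : 0 < n%:R :> R by rewrite ltr0n; lia.
pose b : R := n%:R / k%:R.
have b1 : 1 <= b by rewrite ler_pdivlMr// mul1r ler_nat; lia.
have b0 : 0 < b by rewrite (lt_le_trans _ b1).
have Vge : c * n%:R * b ^+ 2 <= sum_var k n := sum_var_ge k6 kn.
set V := sum_var k n in Vge *; set M := sum_mu k n.
have V0 : 0 < V by apply: lt_le_trans Vge;
  rewrite mulr_gt0 ?exprn_gt0// mulr_gt0.
set s := Num.sqrt V; have s0 : 0 < s by rewrite sqrtr_gt0.
set r := Num.sqrt e; have r0 : 0 < r by rewrite sqrtr_gt0.
(* [b * q] bounds the width [Num.sqrt t] of the smoothing from below *)
set q := Num.sqrt (e * c * n%:R) in q1 *; have q0 := lt_le_trans ltr01 q1.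
have q2 : q ^+ 2 = e * c * n%:R by rewrite sqr_sqrtr// !mulr_ge0// ltW.
pose t := e * V; have t0 : 0 < t by rewrite mulr_gt0.
have stE : Num.sqrt t = r * s by rewrite sqrtrM// ltW.
have bq : b * q <= Num.sqrt t.
  have bq0 : 0 <= b * q by rewrite mulr_ge0 ?ltW.
  rewrite -(ger0_norm bq0) -sqrtr_sqr ler_wsqrtr//.
  rewrite exprMn q2 /t [leLHS](_ : _ = e * (c * n%:R * b ^+ 2)); last by ring.
  by rewrite ler_pM2l.
have st0 : 0 < Num.sqrt t by rewrite sqrtr_gt0.
have := HC k n n 0%N (a * s + M) b t k0 (leqnn n) b1 (lexx _) t0.
rewrite -/M -/V subr0 addrK.
have -> : a * s / Num.sqrt (t + V) = a / Num.sqrt (1 + e).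
  rewrite (_ : t + V = (1 + e) * V); last by rewrite /t; ring.
  rewrite sqrtrM ?addr_ge0 ?ltW// -/s -mulf_div divff ?mulr1 ?gt_eqF//.
rewrite (@eq_rank_mean _ k n _
  (fun y => Phi ((a - (y%:R - M) / s) / r))) => [|y]; last first.
  by congr Phi; rewrite stE; field; rewrite !gt_eqF.
move=> h; apply: le_trans h _.
have A1 : 14 * b ^+ 3 / Num.sqrt t ^+ 3 <= 14 / q ^+ 3.
  rewrite ler_pdivrMr ?exprn_gt0// mulrAC ler_pdivlMr ?exprn_gt0//.
  by rewrite -mulrA -exprMn ler_pM2l// lerXn2r ?nnegrE// ltW// mulr_gt0.
have A2 : 9 * b ^+ 4 / t ^+ 2 <= 9 / q ^+ 3.
  rewrite ler_pdivrMr ?exprn_gt0// mulrAC ler_pdivlMr ?exprn_gt0//.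
  rewrite -mulrA ler_pM2l//; apply: (@le_trans _ _ ((b * q) ^+ 4)).
    rewrite [(b * q) ^+ 4]exprMn ler_pM2l ?exprn_gt0// [leRHS]exprS ler_peMl//.
    by rewrite exprn_ge0// ltW.
  have -> : t ^+ 2 = Num.sqrt t ^+ 4 by rewrite -[in LHS](sqr_sqrtr (ltW t0))
    -exprM.
  by rewrite lerXn2r ?nnegrE// ltW// mulr_gt0.
apply: (@le_trans _ _ (n%:R * (C * (23 / q ^+ 3)))).
  rewrite ler_pM2l// ler_pM2l// (_ : 23 / q ^+ 3 = 14 / q ^+ 3 + 9 / q ^+ 3).
    exact: lerD.
  by rewrite -mulrDl; congr (_ / _); ring.
have nE : n%:R = q ^+ 2 / (e * c) by rewrite q2 mulrC mulKf// gt_eqF// mulr_gt0.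
rewrite nE le_eqVlt; apply/orP; left; apply/eqP.
have ec : e * c != 0 by rewrite gt_eqF// mulr_gt0.
move: (e * c) ec => ec ec0; field; rewrite ec0/= gt_eqF//.
Qed.

(** The indicator function of [r <= x] lies between two shifted normal
    distribution functions of width [s], up to the mass that they put beyond
    [d]. *)
Lemma indicator_smooth_le (r x d s : R) : 0 < s ->
  (r <= x)%R%:R <= Phi ((x + d - r) / s) + (1 - Phi (d / s)) /\
  Phi ((x - d - r) / s) + - Phi (- d / s) <= (r <= x)%R%:R.
Proof.
move=> s0; have P0 y := @std_normal_cdf_ge0 R y;
  have P1 y := @std_normal_cdf_le1 R y.
have [rx|xr] := leP r x; rewrite ?mulr1n ?mulr0n; split.
- have : Phi (d / s) <= Phi ((x + d - r) / s).
    by apply: std_normal_cdf_nd; rewrite ler_pM2r ?invr_gt0//; lra.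
  by lra.
- by have := P1 ((x - d - r) / s); have := P0 (- d / s); lra.
- by have := P0 ((x + d - r) / s); have := P1 (d / s); lra.
- have : Phi ((x - d - r) / s) <= Phi (- d / s).
    by apply: std_normal_cdf_nd; rewrite ler_pM2r ?invr_gt0//; lra.
  by lra.
Qed.

Lemma std_normal_cdf_tails (h : R) : 0 < h -> exists2 K : R, 1 <= K &
  forall y, K <= y -> 1 - Phi y <= h /\ Phi (- y) <= h.
Proof.
move=> h0.
have /cvgrPdist_le/(_ _ h0)[K1 [_ hK1]] := @cvg_std_normal_cdfy1 R.
have /cvgrPdist_le/(_ _ h0)[K2 [_ hK2]] := @cvg_std_normal_cdfNy0 R.
exists (Num.max 1 (Num.max (K1 + 1) (- K2 + 1))); first by rewrite le_max lexx.
move=> y; rewrite !ge_max => /and3P[_ y1 y2]; split.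
  by apply: le_trans (ler_norm _) (hK1 _ _); lra.
have := hK2 (- y); rewrite sub0r normrN ger0_norm ?std_normal_cdf_ge0//.
by apply; lra.
Qed.

(** A quarter of the tolerance [h] goes to each of the shift [d], the smoothing
    variance [e], the normal tails and the exchange error. *)
Lemma kcm_cdf_cvg (k : nat -> nat) (x : R) :
  (\forall n \near \oo, (6 <= k n)%N) ->
  (\forall n \near \oo, ((k n).*2 <= n)%N) ->
  rank_mean (k n) n (fun y =>
    ((y%:R - sum_mu (k n) n) / Num.sqrt (sum_var (k n) n) <= x)%R%:R) 0
    @[n --> \oo] --> Phi x.
Proof.
move=> k6 k2; have [C C0 HC] := rank_mean_smooth_le.
have [L L0 HL] := @std_normal_cdf_lipschitz R.
have c0 : 0 < c by rewrite divr_gt0 ?expR_gt0.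
apply/cvgrPdist_le => h h0; have h4 : 0 < h / 4 by rewrite divr_gt0.
have [K K1 HK] := std_normal_cdf_tails h4.
pose d := h / 4 / L; have d0 : 0 < d by rewrite divr_gt0.
have K0 : 0 < K by rewrite (lt_le_trans _ K1).
pose e := Num.min (h / 4 / (L * (`|x| + 1))) ((d / K) ^+ 2).
have x1 : 0 < `|x| + 1 by rewrite ltr_wpDl.
have e0 : 0 < e by rewrite lt_min ?exprn_gt0 ?andbT ?divr_gt0 ?mulr_gt0.
have eL : L * (`|x| * e) <= h / 4.
  have : e <= h / 4 / (L * (`|x| + 1)) by rewrite ge_min lexx.
  rewrite ler_pdivlMr ?mulr_gt0//; apply: le_trans.
  have -> : L * (`|x| * e) = e * (L * (`|x| + 1)) - e * L by ring.
  by rewrite gerBl mulr_ge0// ltW.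
set s := Num.sqrt e; have s0 : 0 < s by rewrite sqrtr_gt0.
have Kds : K <= d / s.
  rewrite ler_pdivlMr// mulrC -ler_pdivlMr//.
  have dK : 0 <= d / K by rewrite divr_ge0 ?ltW.
  rewrite -(ger0_norm dK) -sqrtr_sqr.
  by rewrite ler_wsqrtr// ge_min lexx orbT.
have [t1 t2] := HK _ Kds; rewrite -mulNr in t2.
have shift a : `|a - x| <= d -> `|Phi (a / Num.sqrt (1 + e)) - Phi x| <= h / 2.
  move=> ad; apply: le_trans (HL _ _) _; set r := Num.sqrt _.
  have r1 : 1 <= r by rewrite -sqrtr1 ler_wsqrtr// lerDl ltW.
  have re : r <= 1 + e.
    have e1 : 0 <= 1 + e by rewrite addr_ge0 ?ltW.
    rewrite -(ger0_norm e1) -sqrtr_sqr.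
    by rewrite ler_wsqrtr// expr2 ler_peMr ?lerDl ?addr_ge0 ?ltW.
  have r0 := lt_le_trans ltr01 r1.
  have v1 : r^-1 <= 1 by rewrite invf_le1.
  have v2 : 1 - r^-1 <= e.
    have -> : 1 - r^-1 = (r - 1) * r^-1 by rewrite mulrBl divff ?mul1r// gt_eqF.
    apply: (@le_trans _ _ (r - 1)); last by rewrite lerBlDl.
    by rewrite ler_piMr// subr_ge0.
  have -> : a / r - x = (a - x) * r^-1 - x * (1 - r^-1) by ring.
  apply: (@le_trans _ _ (L * (d + `|x| * e))).
    rewrite ler_pM2l// (le_trans (ler_normB _ _))// !normrM; apply: lerD.
      by apply: le_trans ad; rewrite ler_piMr// ger0_norm ?invr_ge0// ltW.
    by rewrite ler_wpM2l// ger0_norm// subr_ge0.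
  by rewrite mulrDr {1}/d mulrC divfK ?gt_eqF//; lra.
pose Q := Num.max 1 (C / (e * c * (h / 4))).
have [N _ HN] : \forall n \near \oo, Q ^+ 2 / (e * c) <= n%:R.
  exact: nbhs_infty_ger.
near=> n.
have nQ : Q <= Num.sqrt (e * c * n%:R).
  have Q0 : 0 <= Q by rewrite le_max ler01.
  rewrite -(ger0_norm Q0) -sqrtr_sqr ler_wsqrtr// mulrC -ler_pdivrMr
    ?mulr_gt0//.
  by apply: HN => /=; near: n; exact: nbhs_infty_ge.
have q1 : 1 <= Num.sqrt (e * c * n%:R) by apply: le_trans nQ;
  rewrite le_max lexx.
have q0 := lt_le_trans ltr01 q1.
have err : C / (e * c * Num.sqrt (e * c * n%:R)) <= h / 4.
  have : C / (e * c * (h / 4)) <= Num.sqrt (e * c * n%:R).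
    by apply: le_trans nQ; rewrite le_max lexx orbT.
  rewrite !ler_pdivrMr ?mulr_gt0// => /le_trans; apply.
  by rewrite le_eqVlt; apply/orP; left; apply/eqP; ring.
have kn6 : (6 <= k n)%N by near: n.
have kn2 : ((k n).*2 <= n)%N by near: n.
have k0 : (0 < k n)%N by exact: leq_trans kn6.
set M := sum_mu _ _; set s' := Num.sqrt (sum_var _ _).
have ind y := @indicator_smooth_le ((y%:R - M) / s') x d s s0.
have up := @rank_mean_le R (k n) n _ _ 0%N (fun y => (ind y).1).
have lo := @rank_mean_le R (k n) n _ _ 0%N (fun y => (ind y).2).
rewrite !rank_meanD !rank_mean_cst// in up lo.
have := HC _ _ (x + d) _ kn6 kn2 e0 q1; have := HC _ _ (x - d) _ kn6 kn2 e0 q1.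
rewrite -/M -/s' -/s => Hlo Hup.
have Sup : `|Phi ((x + d) / Num.sqrt (1 + e)) - Phi x| <= h / 2.
  by apply: shift; rewrite addrAC subrr add0r ger0_norm// ltW.
have Slo : `|Phi ((x - d) / Num.sqrt (1 + e)) - Phi x| <= h / 2.
  by apply: shift; rewrite addrAC subrr add0r normrN ger0_norm// ltW.
move: Hlo Hup Sup Slo; rewrite !ler_norml.
move=> /andP[? ?] /andP[? ?] /andP[? ?] /andP[? ?]; apply/andP; split; lra.
Unshelve. all: by end_near. Qed.

End smoothing.

Theorem theorem4 (R : realType) (k : nat -> nat)
    (k_gt0 : forall n, (0 < n)%N -> (0 < k n)%N)
    (k_nd : forall m n, (0 < m)%N -> (m <= n)%N -> (k m <= k n)%N)
    (k_oo : k @ \oo --> \oo)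
    (k_o : (fun n => (k n)%:R : R) =o_\oo (fun n => n%:R : R))
    (d : measure_display) (T : measurableType d) (P : probability T R)
    (Z : {RV P >-> R}) (Z_normal : standard_normal Z) :
  cvg_in_distribution (P := fun n => kcm_prob R n (k n))
    (fun n => std_kcm_inv R n (k n)) Z.
Proof.
move=> x _.
have -> : cdf Z x = (std_normal_cdf x)%:E.
  by rewrite std_normal_cdfE; exact: Z_normal.
have k6 : \forall n \near \oo, (6 <= k n)%N := k_oo _ (nbhs_infty_ge 6).
have k2 : \forall n \near \oo, ((k n).*2 <= n)%N.
  have /eqoP/(_ 2^-1) := k_o; rewrite invr_gt0 ltr0n => /(_ isT).
  apply: filterS => n; rewrite !ger0_norm// ler_pdivlMl// -natrM ler_nat.
  by rewrite mul2n.
apply: cvg_EFin; first by apply: nearW => n; rewrite fin_num_measure.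
have := @kcm_cdf_cvg R k x k6 k2; apply: cvg_trans; apply: near_eq_cvg;
  near=> n.
have kn0 : (0 < k n)%N by apply: k_gt0; near: n; exact: nbhs_infty_gt.
by apply/esym; exact: (congr1 fine (cdf_std_kcm_inv n kn0 x)).
Unshelve. all: by end_near. Qed.
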